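(* If $m,n$ are integers with $3 \leq m \leq n$ and $3 \mid m$, then $\mathrm{dom}_t(P_m \Box P_n) \leq \frac{mn}{3}+\frac{2m}{3}$.
   Context: An orientation of a (finite simple) graph $G$ is a digraph obtained by directing each edge $uv$ of $G$ in exactly one of the two directions $(u,v)$ or $(v,u)$. The orientation is valid if every vertex has in-degree at least $1$. A set $S\subseteq V(D)$ is a total dominating set of a digraph $D$ if every vertex of $D$ (including those in $S$) has an in-neighbor in $S$; $\gamma_t(D)$ is the minimum cardinality of a total dominating set of $D$. For a graph $G$ in which every component contains a cycle (equivalently, $G$ has a valid orientation), $\mathrm{dom}_t(G)$ is the minimum of $\gamma_t(D)$ over all valid orientations $D$ of $G$. $P_m$ is the path on $m$ vertices, and $G\Box H$ is the Cartesian product: vertex set $V(G)\times V(H)$, with $(g,h)$ adjacent to $(g',h')$ iff either $g=g'$ and $hh'\in E(H)$, or $gg'\in E(G)$ and $h=h'$. *)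

(* Defs.v *)
From mathcomp Require Import all_boot.

Set Implicit Arguments.
Unset Strict Implicit.
Unset Printing Implicit Defensive.

Record sgraph := SGraph {
  vertex :> finType;
  adj : rel vertex;
  adj_sym : symmetric adj;
  adj_irrefl : irreflexive adj }.

Definition path_rel (m : nat) : rel 'I_m :=
  fun i j => (i.+1 == j :> nat) || (j.+1 == i :> nat).

Lemma path_rel_sym m : symmetric (@path_rel m).
Proof. by move=> i j; rewrite /path_rel orbC. Qed.

Lemma path_rel_irrefl m : irreflexive (@path_rel m).
Proof. by move=> i; rewrite /path_rel orbb; apply/negbTE; rewrite neq_ltn ltnSn orbT. Qed.

Definition path_graph (m : nat) : sgraph :=
  SGraph (@path_rel_sym m) (@path_rel_irrefl m).

Definition cart_rel (G H : sgraph) : rel (G * H) :=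
  fun x y => ((x.1 == y.1) && adj x.2 y.2) || (adj x.1 y.1 && (x.2 == y.2)).

Lemma cart_rel_sym G H : symmetric (@cart_rel G H).
Proof.
by move=> x y; rewrite /cart_rel [adj x.2 _]adj_sym [adj x.1 _]adj_sym
  [x.1 == _]eq_sym [x.2 == _]eq_sym.
Qed.

Lemma cart_rel_irrefl G H : irreflexive (@cart_rel G H).
Proof. by move=> x; rewrite /cart_rel !adj_irrefl andbF. Qed.

Definition cart_prod (G H : sgraph) : sgraph :=
  SGraph (@cart_rel_sym G H) (@cart_rel_irrefl G H).

(* A digraph on [T] is its set of arcs; [(u, v) \in D] is the arc from u to v. *)
Definition digraph (T : finType) := {set T * T}.

Definition orientation (G : sgraph) (D : digraph G) : bool :=
  [forall u, forall v,
     if adj u v then ((u, v) \in D) (+) ((v, u) \in D) else (u, v) \notin D].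

Definition indegree (T : finType) (D : digraph T) (v : T) : nat :=
  #|[set u | (u, v) \in D]|.

Definition valid_orientation (G : sgraph) (D : digraph G) : bool :=
  orientation D && [forall v, 1 <= indegree D v].

Definition total_dominating (T : finType) (D : digraph T) (S : {set T}) : bool :=
  [forall v, exists u, (u \in S) && ((u, v) \in D)].

(* The default value #|T| of the minimum matters only if [D] has no total
   dominating set at all; see [gamma_tP]. *)
Definition gamma_t (T : finType) (D : digraph T) : nat :=
  \big[minn/#|T|]_(S : {set T} | total_dominating D S) #|S|.

(* The default value #|G| matters only if [G] has no valid orientation; see
   [dom_tP]. *)
Definition dom_t (G : sgraph) : nat :=
  \big[minn/#|G|]_(D : digraph G | valid_orientation D) gamma_t D.

Lemma bigminn_attained (I : finType) (P : pred I) (F : I -> nat) (x : nat) :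
  (exists i, P i) -> (forall i, P i -> F i <= x) ->
  (exists2 i, P i & \big[minn/x]_(i | P i) F i = F i) /\
  (forall i, P i -> \big[minn/x]_(i | P i) F i <= F i).
Proof.
move=> [i0 Pi0] Fx.
have lb i : P i -> \big[minn/x]_(i | P i) F i <= F i.
  move=> Pi; have := mem_index_enum i.
  elim: (index_enum I) => // j s IH; rewrite inE big_cons.
  case/predU1P => [<-|/IH le_s]; first by rewrite Pi geq_minl.
  by case: ifP => // _; apply: leq_trans (geq_minr _ _) le_s.
split=> //.
have : \big[minn/x]_(i | P i) F i = x \/
       exists2 i, P i & \big[minn/x]_(i | P i) F i = F i.
  elim/big_ind: _ => [|a b Ha Hb|i Pi]; [by left | | by right; exists i].
  by rewrite /minn; case: ifP.
case=> // E; exists i0 => //; apply/eqP.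
by rewrite eqn_leq lb //= E Fx.
Qed.

Lemma gamma_tP (T : finType) (D : digraph T) :
  (exists S, total_dominating D S) ->
  (exists2 S : {set T}, total_dominating D S & gamma_t D = #|S|) /\
  (forall S : {set T}, total_dominating D S -> gamma_t D <= #|S|).
Proof. by move=> exS; apply: bigminn_attained => // S _; apply: max_card. Qed.

Lemma gamma_t_le_card (T : finType) (D : digraph T) : gamma_t D <= #|T|.
Proof.
rewrite /gamma_t; elim/big_ind: _ => // [a b Ha _|S _]; last exact: max_card.
exact: leq_trans (geq_minl _ _) Ha.
Qed.

Lemma valid_orientation_total_dominating (G : sgraph) (D : digraph G) :
  valid_orientation D -> total_dominating D [set: G].
Proof.
case/andP=> _ /forallP indeg; apply/forallP=> v.
have /card_gt0P[u] := indeg v; rewrite inE => uv.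
by apply/existsP; exists u; rewrite inE.
Qed.

Lemma dom_tP (G : sgraph) :
  (exists D : digraph G, valid_orientation D) ->
  (exists2 D : digraph G, valid_orientation D & dom_t G = gamma_t D) /\
  (forall D : digraph G, valid_orientation D -> dom_t G <= gamma_t D).
Proof. by move=> exD; apply: bigminn_attained => // D _; apply: gamma_t_le_card. Qed.

(* Main.v *)
Require Import Defs.
From mathcomp Require Import all_boot all_order all_algebra.
From mathcomp Require Import zify lra.
Import Order.TTheory GRing.Theory Num.Theory.
Local Open Scope ring_scope.

(** A total dominating set [S] of a suitably oriented graph amounts to a choice,
    for each vertex [v], of a neighbour [f v] in [S] from which [v] receives an
    arc.  Such a choice is realised by an orientation as soon as no edge is
    asked to point both ways, that is, [f (f v) <> v] for all [v]
    ([dom_t_le_card]); validity is then automatic.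

    Since [3] divides [m], the grid splits into [m / 3] horizontal strips of
    three rows, which can be dominated separately: edges between strips may be
    directed at will.  In one strip let [S] be the whole middle row together
    with the first two vertices [a], [b] of the top row, [n + 2] vertices in all.
    The middle row dominates the outer rows, except for [a], and, directed as a
    path from left to right, dominates itself, except for its first vertex [c].
    The two exceptions are handled by [b -> a -> c]:
<<
      a <- b    o    o
      |    ^    ^    ^
      v    |    |    |
      c -> o -> o -> o
      |    |    |    |
      v    v    v    v
      o    o    o    o
>>
    Summing over the strips gives [(m / 3) * (n + 2)] ([dom_t_grid_le]). *)

(** The edges that are not of the form [f v -> v] have to be directed somehow;
    the enumeration of the vertices serves as an arbitrary tie-break. *)
Lemma dom_t_le_card (G : sgraph) (S : {set G}) (f : G -> G) :
  (forall v, f v \in S) -> (forall v, adj (f v) v) ->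
  (forall v, f (f v) != v) -> (dom_t G <= #|S|)%N.
Proof.
move=> fS f_adj f_no2.
pose D : digraph G := [set e | adj e.1 e.2 &&
  ((f e.2 == e.1) || (f e.1 != e.2) && (enum_rank e.1 < enum_rank e.2)%N)].
have fD v : (f v, v) \in D by rewrite inE /= f_adj eqxx.
have D_valid : valid_orientation D.
  apply/andP; split; last first.
    by apply/forallP=> v; apply/card_gt0P; exists (f v); rewrite inE.
  apply/forallP=> u; apply/forallP=> v; rewrite !inE /= [adj v u]adj_sym.
  case: ifP => [uv /=|-> //]; rewrite ?uv /=.
  have [fvu|fvu] := eqVneq (f v) u.
    have fuv : (f u == v) = false by rewrite -fvu; apply/negbTE.
    by rewrite fuv.
  have [//|fuv /=] := eqVneq (f u) v.
  have : enum_rank u != enum_rank v :> nat.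
    apply/negP=> /eqP /val_inj /enum_rank_inj uv_eq.
    by move: uv; rewrite uv_eq adj_irrefl.
  by case: ltngtP.
have D_dom : total_dominating D S.
  by apply/forallP=> v; apply/existsP; exists (f v); rewrite fS fD.
have [_ /(_ D D_valid) dom_le] := dom_tP (ex_intro _ D D_valid).
have [_ /(_ S D_dom) gamma_le] := gamma_tP (ex_intro _ S D_dom).
exact: leq_trans dom_le gamma_le.
Qed.

(** The in-neighbour chosen for the vertex in row [i] and column [j]; the
    residue of [i] modulo 3 is the position of the row within its strip. *)
Definition strip_pred (i j : nat) : nat * nat :=
  match (i %% 3)%N with
  | 0 => if j == 0%N then (i, 1%N) else (i.+1, j)
  | 1 => if j == 0%N then (i.-1, 0%N) else (i, j.-1)
  | _ => (i.-1, j)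
  end.

Variant strip_pred_spec (i j : nat) : nat * nat -> Prop :=
  | StripTopCorner of (i %% 3 = 0)%N & j = 0%N : strip_pred_spec i j (i, 1%N)
  | StripTop of (i %% 3 = 0)%N & (0 < j)%N : strip_pred_spec i j (i.+1, j)
  | StripMiddleStart of (i %% 3 = 1)%N & j = 0%N :
      strip_pred_spec i j (i.-1, 0%N)
  | StripMiddle of (i %% 3 = 1)%N & (0 < j)%N : strip_pred_spec i j (i, j.-1)
  | StripBottom of (i %% 3 = 2)%N : strip_pred_spec i j (i.-1, j).

Lemma strip_predP i j : strip_pred_spec i j (strip_pred i j).
Proof.
rewrite /strip_pred; case E: (i %% 3)%N => [|[|r]].
- by case: eqP => j0; constructor=> //; lia.
- by case: eqP => j0; constructor=> //; lia.
by constructor; lia.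
Qed.

Lemma strip_pred_bound m n i j : (3 %| m)%N -> (1 < n)%N ->
  (i < m)%N -> (j < n)%N ->
  ((strip_pred i j).1 < m)%N /\ ((strip_pred i j).2 < n)%N.
Proof. by move=> m3 n1 im jn; case: strip_predP => /= *; lia. Qed.

Lemma strip_pred_adj i j :
  let p := strip_pred i j in
  (p.1 = i /\ (p.2.+1 = j \/ j.+1 = p.2)) \/
  ((p.1.+1 = i \/ i.+1 = p.1) /\ p.2 = j).
Proof. by case: strip_predP => /= *; lia. Qed.

Lemma strip_pred_no2 i j :
  let p := strip_pred i j in strip_pred p.1 p.2 <> (i, j).
Proof.
apply/eqP; case: (strip_predP i j) => /= *.
all: by case: strip_predP => /= *; rewrite xpair_eqE; lia.
Qed.

Lemma strip_pred_range i j :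
  let p := strip_pred i j in
  (p.1 %% 3 = 1)%N \/ ((p.1 %% 3 = 0)%N /\ (p.2 < 2)%N).
Proof. by case: strip_predP => /= *; lia. Qed.

Lemma dom_t_grid_le (k n : nat) : (0 < k)%N -> (1 < n)%N ->
  (dom_t (cart_prod (path_graph (3 * k)) (path_graph n)) <= k * (n + 2))%N.
Proof.
move=> k_gt0 n_gt1.
case: n n_gt1 => // n n_gt1.
have [m mk] : exists m, (3 * k)%N = m.+1 by exists (3 * k).-1; lia.
have m3 : (3 %| m.+1)%N by rewrite -mk dvdn_mulr.
rewrite mk.
pose G := cart_prod (path_graph m.+1) (path_graph n.+1).
pose f (v : G) : G :=
  let p := strip_pred v.1 v.2 in (inord p.1 : 'I_m.+1, inord p.2 : 'I_n.+1).
(* The dominating set is taken as the image of [g], indexed by a strip and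
   either a vertex of its middle row or one of the two extra top vertices, so
   that the size of the index type bounds its cardinality. *)
pose g (x : 'I_k * ('I_n.+1 + 'I_2)) : G :=
  match x with
  | (r, inl j) => (inord (3 * r).+1 : 'I_m.+1, j)
  | (r, inr b) => (inord (3 * r) : 'I_m.+1, inord b : 'I_n.+1)
  end.
have fE v : ((f v).1 : nat, (f v).2 : nat) = strip_pred v.1 v.2.
  have [b1 b2] := strip_pred_bound _ _ _ _ m3 n_gt1 (ltn_ord v.1) (ltn_ord v.2).
  by rewrite /f /= !inordK //; case: strip_pred.
have f1E v : ((f v).1 : nat) = (strip_pred v.1 v.2).1 by rewrite -fE.
have f2E v : ((f v).2 : nat) = (strip_pred v.1 v.2).2 by rewrite -fE.
apply: (@leq_trans #|g @: setT|); last first.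
  rewrite (leq_trans (leq_imset_card _ _)) //.
  by rewrite cardsT card_prod card_sum !card_ord.
apply: (@dom_t_le_card G (g @: setT) f) => v.
- have := strip_pred_range v.1 v.2; rewrite /= -f1E -f2E.
  case: (f v) => p q /= p_range.
  have pm := ltn_ord p; have pk : (p %/ 3 < k)%N by lia.
  case: p_range => [mid|[top q2]]; apply/imsetP.
    exists (Ordinal pk, inl q) => //=.
    by congr pair; apply: val_inj; rewrite /= inordK; lia.
  exists (Ordinal pk, inr (Ordinal q2)) => //=.
  by congr pair; apply: val_inj; rewrite /= inordK; lia.
- have := strip_pred_adj v.1 v.2; rewrite /= -f1E -f2E /cart_rel /= /path_rel.
  by rewrite -!val_eqE /=; lia.
apply/eqP=> ffv; apply: (strip_pred_no2 v.1 v.2).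
by rewrite /= -f1E -f2E -fE ffv.
Qed.

Theorem theorem4p5 (m n : nat) (h3m : (3 <= m)%N) (hmn : (m <= n)%N)
    (hdiv : (3 %| m)%N) :
  (dom_t (cart_prod (path_graph m) (path_graph n)))%:R
    <= (m%:R * n%:R) / 3%:R + (2%:R * m%:R) / 3%:R :> rat.
Proof.
case/dvdnP: hdiv => k mE; rewrite mulnC in mE; subst m.
have dom_le : (dom_t (cart_prod (path_graph (3 * k)) (path_graph n))
               <= k * (n + 2))%N by apply: dom_t_grid_le; lia.
rewrite -(ler_nat rat) in dom_le; apply: (le_trans dom_le).
by rewrite !natrM natrD; lra.
Qed.
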